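(* Let $\mathcal{P}$ be a polyhedron which is a bipyramid over an $n$-gon ($n\ge 3$). Then the edges of $\mathcal{P}$ can be labelled coherently, that is, labelled with integers so that for every face, oriented by the outward pointing normal, the labels read anticlockwise from some choice of starting edge are strictly increasing.
   Context: A bipyramid over an $n$-gon is the polyhedron obtained by gluing two pyramids over the same $n$-gon along their common base, one on each side; the base disappears as a face but its edges remain, so the faces are $2n$ triangles. ''Anticlockwise'' is as seen by an observer outside the polyhedron. *)

(* Defs.v *)
From HB Require Import structures.
From mathcomp Require Import all_boot all_order all_algebra.
From mathcomp Require Import finmap.
From mathcomp Require Import all_classical all_reals all_analysis.

Set Implicit Arguments.
Unset Strict Implicit.
Unset Printing Implicit Defensive.

Import Order.TTheory GRing.Theory Num.Theory.
Import numFieldNormedType.Exports.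

Local Open Scope classical_set_scope.
Local Open Scope ring_scope.

Section Polyhedra.
Context {R : realType}.

Notation plane := 'rV[R]_2.
Notation space := 'rV[R]_3.

Definition barycenter (d : nat) (x y : 'rV[R]_d) (t : R) : 'rV[R]_d :=
  (1 - t) *: x + t *: y.

(* [\det (u, v, w)], positive iff [u, v, w] is right-handed. *)
Definition triple (u v w : space) : R :=
  \det (col_mx u (col_mx v w) : 'M[R]_(1 + (1 + 1), 3)).

(* A solid together with its faces.  Every face is a list of its vertices in  *)
(* cyclic order; the direction of travel and the first vertex carry no        *)
(* information.                                                               *)
Record polyhedron := Polyhedron {
  solid : set space ;
  faces : seq (seq space) }.

(* An edge is the unordered pair of its endpoints. *)
Definition boundary_edges (c : seq space) : seq {fset space} :=
  [seq [fset x; next c x]%fset | x <- c].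

(* The relative interior of a face with vertex list [c], for a convex face. *)
Definition face_interior (c : seq space) : set space :=
  [set x | exists l : space -> R,
    [/\ forall v, v \in c -> 0 < l v,
        \sum_(v <- c) l v = 1
      & x = \sum_(v <- c) l v *: v]].

(* [w] is normal to the face, and across the face it leads out of [S]. *)
Definition outward_normal (S : set space) (c : seq space) (w : space) : Prop :=
  (forall x y, x \in c -> y \in c -> w *m (y - x)^T = 0) /\
  (forall x, face_interior c x ->
     \forall t \near 0^'+, ~ S (x + t *: w) /\ S (x - t *: w)).

(* The sum is twice the signed area enclosed by [c], scaled by the length of  *)
(* [w]: it is positive iff [c] runs anticlockwise for an observer towards     *)
(* whom [w] points.                                                           *)
Definition anticlockwise (S : set space) (c : seq space) : Prop :=
  exists w, outward_normal S c w /\ 0 < \sum_(x <- c) triple w x (next c x).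

Definition traversal (f c : seq space) : Prop :=
  exists k, c = rot k f \/ c = rot k (rev f).

(* Only the values of [label] on the edges of [P] matter.  The first edge of  *)
(* the traversal [c] is the starting edge.                                    *)
Definition coherent (P : polyhedron) (label : {fset space} -> int) : Prop :=
  forall f, f \in faces P ->
    exists c, [/\ traversal f c,
                  anticlockwise (solid P) c
                & sorted <%R [seq label e | e <- boundary_edges c]].

(* [D] is the n-gon (not necessarily convex) with successive corners [q].     *)
(* The first clause says that the closed polygonal line through [q] is        *)
(* simple, the second that every [q i] is a genuine corner; the remaining     *)
(* ones characterise the closed region that this Jordan curve encloses.       *)
Definition is_ngon (n : nat) (q : 'I_n -> plane) (D : set plane) : Prop :=
  [/\ (forall (i j : 'I_n) (s t : R), 0 <= s < 1 -> 0 <= t < 1 ->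
         barycenter (q i) (q (ordS i)) s = barycenter (q j) (q (ordS j)) t ->
         i = j /\ s = t),
      (forall i : 'I_n,
         \det (col_mx (q (ordS i) - q i) (q (ordS (ordS i)) - q i)
               : 'M[R]_(1 + 1, 2)) != 0),
      compact D,
      closure D° = D
    & D `\` D° =
        [set x | exists (i : 'I_n) (t : R),
           0 <= t <= 1 /\ x = barycenter (q i) (q (ordS i)) t]].

(* The affine embedding of the plane in space with origin [o] and directions  *)
(* the rows of [E].                                                           *)
Definition place (o : space) (E : 'M[R]_(2, 3)) (x : plane) : space :=
  o + x *m E.

Definition pyramid (n : nat) (p : 'I_n -> space) (B : set space) (a : space) :
    polyhedron :=
  Polyhedron
    [set x | exists (y : space) (t : R),
       [/\ B y, 0 <= t <= 1 & x = barycenter y a t]]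
    (codom p :: [seq [:: p i; p (ordS i); a] | i : 'I_n]).

(* Gluing along the common face [f], which disappears. *)
Definition glue (f : seq space) (P Q : polyhedron) : polyhedron :=
  Polyhedron (solid P `|` solid Q) (rem f (faces P) ++ rem f (faces Q)).

(* The last but one condition says that the apices [a] and [b] lie strictly   *)
(* on opposite sides of the plane of the base.                                *)
Definition is_bipyramid (n : nat) (P : polyhedron) : Prop :=
  exists (q : 'I_n -> plane) (D : set plane) (o : space) (E : 'M[R]_(2, 3))
         (a b : space),
    let p := place o E \o q in
    let B := place o E @` D in
    [/\ is_ngon q D,
        row_free E,
        \det (col_mx E (a - o) : 'M[R]_(2 + 1, 3)) *
          \det (col_mx E (b - o) : 'M[R]_(2 + 1, 3)) < 0
      & P = glue (codom p) (pyramid p B a) (pyramid p B b)].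

End Polyhedra.

Arguments polyhedron : clear implicits.

(* Main.v *)
Require Import Defs.
From mathcomp Require Import all_boot all_order all_algebra.
From mathcomp Require Import finmap.
From mathcomp Require Import all_classical all_reals all_analysis.
From mathcomp Require Import ring lra zify.

(** The base edges, traversed in their cyclic order, all have the interior of the
    base polygon [D] on the same side ([ngon_agrees]).  This needs no Jordan curve
    theorem, because [D] is given as the closure of its interior with the polygonal
    line as frontier: a segment missing the frontier lies inside [D] or misses it
    ([avoid_frontier]), so near a point of an open edge each side of the edge lies
    in [D] or misses it, and exactly one of the two lies in [D] ([near_agrees]).
    This inner side is locally constant along the edge ([edge_agreesE]), and it
    passes from an edge to the next because the small convex sector at their common
    corner is on the same side of both ([corner_agrees]).

    Projecting from an apex to the plane of the base carries the bipyramid near a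
    lateral face to [D] near an edge ([solid_at_coord]), so that a multiple of the
    vector product of two sides of the face is an outward normal, with the sign
    dictated by the inner side and by the half-space of the apex ([face_normal]).
    Exchanging the apices if necessary, the base [p 0], ..., [p (n - 1)] runs
    anticlockwise seen from [a]; then the faces read anticlockwise as
    [p i, p (i + 1), a] and [p (i + 1), p i, b].

    Label the edges from [a] to [p 0], [p 1], [p 2], ... by 1, -1, -2, ..., those
    from [b] by -1, 1, 2, ..., the base edges by [n], except the one from
    [p (n - 1)] to [p 0], which gets 0.  In cyclic order, for [i < n - 1], the first
    face on the [i]-th edge reads top (i + 1) < top i < n and the second
    bottom i < bottom (i + 1) < n; the two faces on the last edge read
    -(n - 1) < 0 < 1 and -1 < 0 < n - 1. *)

Set Implicit Arguments.
Unset Strict Implicit.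
Unset Printing Implicit Defensive.

Import Order.TTheory GRing.Theory Num.Theory.
Import numFieldNormedType.Exports.

(** * Segments and sides of a line in the plane *)

Section Plane.
Local Open Scope classical_set_scope.
Local Open Scope ring_scope.
Context {R : realType}.

Lemma barycenter0 d (x y : 'rV[R]_d) : barycenter x y 0 = x.
Proof. by rewrite /barycenter subr0 scale1r scale0r addr0. Qed.

Lemma barycenter1 d (x y : 'rV[R]_d) : barycenter x y 1 = y.
Proof. by rewrite /barycenter subrr scale0r scale1r add0r. Qed.

Lemma barycenter_continuous d (x y : 'rV[R]_d) : continuous (barycenter x y).
Proof.
move=> t; apply: cvgD; apply: cvgZ; try exact: cvg_cst; last exact: cvg_id.
by apply: cvgB; [exact: cvg_cst|exact: cvg_id].
Qed.

(** The closed segment with endpoints [x] and [y]. *)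
Definition edge d (x y : 'rV[R]_d) : set 'rV[R]_d := barycenter x y @` `[0, 1].

Lemma closed_edge d (x y : 'rV[R]_d) : closed (edge x y).
Proof.
apply: compact_closed; first exact: norm_hausdorff.
apply: continuous_compact; last exact: segment_compact.
exact/continuous_subspaceT/barycenter_continuous.
Qed.

(** On a segment missing the frontier of [D], the traces of [D] and of its
    interior agree, so membership in [D] is both open and closed there, hence
    constant. *)
Lemma avoid_frontier d (D : set 'rV[R]_d) (u v : 'rV[R]_d) :
  closed D -> (forall x, edge u v x -> ~ (D `\` D°) x) -> (D u <-> D v).
Proof.
move=> Dcl uvF; pose f := barycenter u v.
have fc : continuous f by exact: barycenter_continuous.
have fI t : `[0, 1]%classic t -> D (f t) -> D° (f t).
  by move=> t01 Dft; apply: contrapT => nD; apply: (uvF (f t)) => //; exists t.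
have H0 : `[(0:R), 1]%classic 0 by rewrite /= in_itv /= lexx ler01.
have H1 : `[(0:R), 1]%classic 1 by rewrite /= in_itv /= lexx ler01.
have f0 : f 0 = u := barycenter0 u v.
have f1 : f 1 = v := barycenter1 u v.
have all_in t : `[0, 1]%classic t -> D (f t) -> `[0, 1] `&` f @^-1` D = `[0, 1]%classic.
  move=> t01 Dt; apply: (segment_connected (a := 0) (b := 1)); first by exists t.
  - exists (f @^-1` D°); first by apply: open_comp => //; exact: open_interior.
    apply/seteqP; split=> s /= [s01 Ds]; split=> //; first exact: fI.
    exact: interior_subset.
  - by exists (f @^-1` D) => //; apply: closed_comp.
by rewrite -f0 -f1; split=> Df; [move: (all_in 0 H0 Df)|move: (all_in 1 H1 Df)];
   move=> /seteqP[_ sub]; [have [] := sub 1 H1|have [] := sub 0 H0].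
Qed.

Lemma barycenter_ball d (x u v : 'rV[R]_d) e y :
  ball x e u -> ball x e v -> edge u v y -> ball x e y.
Proof.
rewrite -!ball_normE /= => xu xv [t /=]; rewrite in_itv /= => /andP[t0 t1] <-.
have -> : x - barycenter u v t = (1 - t) *: (x - u) + t *: (x - v).
  by apply/rowP => i; rewrite !mxE; ring.
apply: le_lt_trans (ler_normD _ _) _; rewrite !normrZ !ger0_norm ?subr_ge0 //.
set A := `|x - u|; set B := `|x - v|; have [Am Bm] : A <= Num.max A B /\ B <= Num.max A B.
  by rewrite !le_max !lexx orbT.
have me : Num.max A B < e by rewrite gt_max xu.
apply: le_lt_trans me; move: (Num.max A B) Am Bm => m Am Bm.
have := ler_wpM2l t0 Bm; have := ler_wpM2l _ Am; rewrite -subr_ge0 in t1.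
by move=> /(_ _ t1); lra.
Qed.

(** The determinant of two plane vectors. *)
Definition det2 (u v : 'rV[R]_2) : R := u 0 0 * v 0 1 - u 0 1 * v 0 0.

(** Twice the signed area of the triangle [p r x]: positive iff [x] lies to the
    left of the line directed from [p] to [r], zero iff [x] is on that line when
    [p != r]. *)
Definition side (p r x : 'rV[R]_2) : R := det2 (r - p) (x - p).

Lemma side_barycenter p r x y t :
  side p r (barycenter x y t) = (1 - t) * side p r x + t * side p r y.
Proof. by rewrite /side /det2 !mxE; ring. Qed.

Lemma side_edge p r x : edge p r x -> side p r x = 0.
Proof. by move=> [t _ <-]; rewrite /side /det2 !mxE; ring. Qed.

Lemma side_start p r : side p r p = 0.
Proof. by rewrite /side /det2 !mxE; ring. Qed.

Lemma side_end p r : side p r r = 0.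
Proof. by rewrite /side /det2 !mxE; ring. Qed.

Lemma affine_comb_continuous (T : topologicalType) (f g : T -> R) (a b c : R) :
  continuous f -> continuous g -> continuous (fun x => a * f x + b * g x + c).
Proof.
move=> fc gc x; apply: cvgD; last exact: cvg_cst.
by apply: cvgD; apply: cvgMl_tmp; [exact: fc|exact: gc].
Qed.

Lemma side_continuous p r : continuous (side p r).
Proof.
have -> : side p r = fun x => (p - r) 0 1 * x 0 0 + (r - p) 0 0 * x 0 1 + side p r 0.
  by apply/funext => x; rewrite /side /det2 !mxE; ring.
by apply: affine_comb_continuous; exact: coord_continuous.
Qed.

Lemma row2P (u v : 'rV[R]_2) : u 0 0 = v 0 0 -> u 0 1 = v 0 1 -> u = v.
Proof.
move=> uv0 uv1; apply/rowP => -[[|[|//]] i].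
  by rewrite (_ : Ordinal i = 0) //; exact: val_inj.
by rewrite (_ : Ordinal i = 1) //; exact: val_inj.
Qed.

(** The witness is [p] translated by the direction [r - p] turned through a
    quarter. *)
Lemma side_off p r : p != r -> exists y, side p r y != 0.
Proof.
move=> pr; exists (p + \row_j (if j == 0 then p 0 1 - r 0 1 else r 0 0 - p 0 0)).
have -> : side p r (p + \row_j (if j == 0 then p 0 1 - r 0 1 else r 0 0 - p 0 0)) =
    (r 0 0 - p 0 0) ^+ 2 + (r 0 1 - p 0 1) ^+ 2.
  by rewrite /side /det2 !mxE /=; ring.
apply: contra pr; rewrite paddr_eq0 ?sqr_ge0 // !sqrf_eq0 !subr_eq0.
by move=> /andP[/eqP r0 /eqP r1]; apply/eqP/row2P.
Qed.

(** Every neighbourhood of a point of a line meets both sides of the line. *)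
Lemma near_side p r x (U : set 'rV[R]_2) c :
  p != r -> side p r x = 0 -> nbhs x U -> c != 0 ->
  exists2 u, U u & 0 < c * side p r u.
Proof.
(* move from [x] towards, or away from, a point [y] off the line: the factor
   [k] has the sign that makes [c * side] positive *)
move=> /side_off[y y0] x0 Ux c0; pose k := c * side p r y.
have k0 : k != 0 by rewrite mulf_neq0.
have cv : barycenter x y (t * k) @[t --> 0^'+] --> x.
  have {2}<- : barycenter x y (0 * k) = x by rewrite mul0r barycenter0.
  apply: cvg_within_filter; apply: (cvg_comp (fun t => t * k)); last exact: barycenter_continuous.
  by apply: cvgMr_tmp; exact: cvg_id.
have : \forall t \near 0^'+, U (barycenter x y (t * k)) /\ 0 < t.
  by apply: filterI; [exact: cv|exact: nbhs_right_gt].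
move=> /filter_ex[t [Ut t0]]; exists (barycenter x y (t * k)) => //.
rewrite side_barycenter x0 mulr0 add0r mulrCA -mulrA -/k -expr2.
by rewrite mulr_gt0 // exprn_even_gt0.
Qed.

End Plane.

(** * The side of the edges on which a simple polygon lies *)

Section Polygon_interior.
Local Open Scope classical_set_scope.
Local Open Scope ring_scope.
Context {R : realType}.

Lemma det_mx22 (K : comNzRingType) (A : 'M[K]_2) :
  \det A = A 0 0 * A 1 1 - A 0 1 * A 1 0.
Proof.
have l00 : lift ord0 ord0 = 1 :> 'I_2 by exact: val_inj.
have l10 : lift 1 ord0 = 0 :> 'I_2 by exact: val_inj.
rewrite (expand_det_row _ ord0) !big_ord_recl big_ord0 /cofactor !det_mx11 !mxE /=.
by rewrite l00 l10 addr0 expr0 expr1 mul1r mulN1r mulrN.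
Qed.

Lemma det_mx33 (K : comNzRingType) (A : 'M[K]_3) : \det A =
  A 0 0 * (A 1 1 * A 2 2 - A 1 2 * A 2 1) -
  A 0 1 * (A 1 0 * A 2 2 - A 1 2 * A 2 0) +
  A 0 2 * (A 1 0 * A 2 1 - A 1 1 * A 2 0).
Proof.
have k00 : lift ord0 ord0 = 1 :> 'I_2 by exact: val_inj.
have l00 : lift ord0 0 = 1 :> 'I_3 by exact: val_inj.
have l01 : lift ord0 1 = 2 :> 'I_3 by exact: val_inj.
have l10 : lift 1 0 = 0 :> 'I_3 by exact: val_inj.
have l11 : lift 1 1 = 2 :> 'I_3 by exact: val_inj.
have l20 : lift 2 0 = 0 :> 'I_3 by exact: val_inj.
have l21 : lift 2 1 = 1 :> 'I_3 by exact: val_inj.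
rewrite (expand_det_row _ ord0) !big_ord_recl big_ord0 /cofactor !det_mx22 !mxE /=.
rewrite k00 l00 l01 l10 l11 l20 l21 /= addr0 expr0 expr1 sqrrN expr1n !mul1r.
by rewrite mulN1r mulrN addrA.
Qed.

Lemma col_mx2E (u v : 'rV[R]_2) j :
  let A : 'M[R]_(1 + 1, 2) := col_mx u v in A 0 j = u 0 j /\ A 1 j = v 0 j.
Proof.
split.
  by rewrite -(col_mxEu u v 0 j); congr (col_mx u v _ _); exact: val_inj.
by rewrite -(col_mxEd u v 0 j); congr (col_mx u v _ _); exact: val_inj.
Qed.

Lemma col_mx3E (u v w : 'rV[R]_3) j :
  let A : 'M[R]_(1 + (1 + 1), 3) := col_mx u (col_mx v w) in
  [/\ A 0 j = u 0 j, A 1 j = v 0 j & A 2 j = w 0 j].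
Proof.
split.
- by rewrite -(col_mxEu u (col_mx v w) 0 j); congr (col_mx _ _ _ _); exact: val_inj.
- rewrite -(col_mxEu v w 0 j) -(col_mxEd u (col_mx v w)).
  by congr (col_mx _ _ _ _); exact: val_inj.
- rewrite -(col_mxEd v w 0 j) -(col_mxEd u (col_mx v w)).
  by congr (col_mx _ _ _ _); exact: val_inj.
Qed.

Lemma det_col_mx2 (u v : 'rV[R]_2) :
  \det (col_mx u v : 'M[R]_(1 + 1, 2)) = det2 u v.
Proof.
by rewrite det_mx22 /det2; have [-> ->] := col_mx2E u v 0; have [-> ->] := col_mx2E u v 1.
Qed.

(** Induction around the cycle. *)
Lemma ordS_ind n (P : 'I_n -> Prop) (i0 : 'I_n) :
  P i0 -> (forall i, P i -> P (ordS i)) -> forall i, P i.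
Proof.
move=> P0 PS i.
have Pk k : P (iter k (@ordS n) i0) by elim: k => //= k /PS.
have iterE k : iter k (@ordS n) i0 = ((i0 + k) %% n)%N :> nat.
  elim: k => [|k /= ->]; first by rewrite addn0 modn_small.
  by rewrite -addn1 modnDml addn1 addnS.
suff -> : i = iter (n + i - i0)%N (@ordS n) i0 by [].
apply/val_inj; rewrite /= iterE subnKC; first by rewrite modnDl modn_small.
by rewrite (leq_trans (ltnW (ltn_ord i0))) // leq_addr.
Qed.

Lemma convex_neq0 (c x y t : R) : `[0, 1]%classic t ->
  0 < c * x -> 0 < c * y -> (1 - t) * x + t * y != 0.
Proof.
rewrite /= in_itv /= => /andP[t0 t1] cx cy.
suff : 0 < c * ((1 - t) * x + t * y) by apply: contraTneq => ->; rewrite mulr0 ltxx.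
rewrite mulrDr !(mulrCA c); move: t0; rewrite le_eqVlt => /predU1P[<-|t0].
  by rewrite subr0 mul0r addr0 mul1r.
apply: ltr_wpDl; last exact: mulr_gt0.
by rewrite mulr_ge0 ?subr_ge0 // ltW.
Qed.

(** Among finitely many closed sets, some neighbourhood of [x] meets only those
    that contain [x]. *)
Lemma near_closed (T : topologicalType) (I : finType) (F : I -> set T)
    (Q : I -> Prop) (x : T) :
  (forall j, closed (F j)) -> (forall j, F j x -> Q j) ->
  \forall u \near x, forall j, F j u -> Q j.
Proof.
move=> Fcl FQ; apply: filter_forall => j.
have [Qj|nQj] := pselect (Q j); first exact: filterE.
apply: (@filterS _ _ _ (~` F j)) => [u Fu /Fu//|].
by apply: open_nbhs_nbhs; split=> [|/FQ//]; exact: closed_openC.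
Qed.

Section Polygon.
Variables (n : nat) (q : 'I_n -> 'rV[R]_2) (D : set 'rV[R]_2).
Hypothesis qD : is_ngon q D.

Notation corner i := (q (ordS i)).
Notation qedge i := (edge (q i) (q (ordS i))).
Notation qside i := (side (q i) (q (ordS i))).

Lemma ngon_inj : injective q.
Proof.
case: qD => simple _ _ _ _ i j qij.
have h0 : 0 <= (0:R) < 1 by rewrite lexx ltr01.
by have [] := simple i j 0 0 h0 h0; rewrite ?barycenter0.
Qed.

Lemma ngon_corner i : qside i (corner (ordS i)) != 0.
Proof. by case: qD => _ /(_ i); rewrite det_col_mx2. Qed.

Lemma ngon_edge_neq i : q i != corner i.
Proof.
apply: contra (ngon_corner i) => /eqP e.
by rewrite /side -e /det2 !mxE !subrr !mul0r subrr.
Qed.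

Lemma ngon_closed : closed D.
Proof. by case: qD => _ _ /(compact_closed (@norm_hausdorff _ _)). Qed.

Lemma ngon_frontier x : (D `\` D°) x <-> exists i, qedge i x.
Proof.
case: qD => _ _ _ _ ->; split=> [[i [t [t01 ->]]]|[i [t /= t01 <-]]]; exists i.
  by exists t; rewrite //= in_itv.
by exists t; split => //; rewrite in_itv in t01.
Qed.

Lemma near_open_edge i s : 0 < s < 1 ->
  \forall u \near barycenter (q i) (corner i) s, forall j, qedge j u -> j = i.
Proof.
move=> /andP[s0 s1]; apply: near_closed => j; first exact: closed_edge.
move=> [t /=]; rewrite in_itv /= => /andP[t0]; rewrite le_eqVlt => t1 jt.
case: qD => simple _ _ _ _.
have s01 : 0 <= s < 1 by rewrite ltW.
have [t1'|{}t1] := predU1P t1.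
  have h0 : 0 <= (0:R) < 1 by rewrite lexx ltr01.
  move: jt; rewrite t1' barycenter1 -{1}(barycenter0 (corner j) (corner (ordS j))) => jt.
  by have [_ z] := simple _ _ _ _ h0 s01 jt; rewrite -z ltxx in s0.
by have [] := simple j i t s _ s01 jt; rewrite ?t0.
Qed.

Lemma near_corner i :
  \forall u \near corner i, forall j, qedge j u -> j = i \/ j = ordS i.
Proof.
apply: near_closed => j; first exact: closed_edge.
move=> [t /=]; rewrite in_itv /= => /andP[t0]; rewrite le_eqVlt => t1 jt.
have [t1'|{}t1] := predU1P t1.
  by left; move: jt; rewrite t1' barycenter1 => /ngon_inj/(can_inj (@ordSK n)).
case: qD => simple _ _ _ _.
have h0 : 0 <= (0:R) < 1 by rewrite lexx ltr01.
have [] := simple j (ordS i) t 0 _ h0; rewrite ?t0 ?barycenter0 //.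
by right.
Qed.

(** The points at which [D] coincides with the side of the [i]-th edge selected by
    the sign of [c]: the left side if [0 < c], the right side if [c < 0].  Nothing
    is asked of the points of the line that carries the edge. *)
Definition agrees_with_side i c : set 'rV[R]_2 :=
  [set u | (0 < c * qside i u -> D u) /\ (c * qside i u < 0 -> ~ D u)].

(** A half of a ball that meets no edge but the [i]-th lies inside [D] or misses
    it. *)
Lemma half_ball_constant i c x e :
  (forall u, ball x e u -> forall j, qedge j u -> j = i) ->
  forall u v, ball x e u -> ball x e v ->
  0 < c * qside i u -> 0 < c * qside i v -> D u <-> D v.
Proof.
move=> xe u v xu xv cu cv; apply: avoid_frontier ngon_closed _ => y uvy.
move=> /ngon_frontier[j jy]; have yx := barycenter_ball xu xv uvy.
move: (side_edge jy); rewrite (xe _ yx _ jy).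
by case: uvy => t t01 <-; rewrite side_barycenter; exact/eqP/(convex_neq0 t01 cu cv).
Qed.

(** Near a point of an open edge exactly one side lies in [D]: if both did, the
    point would be interior to [D]; if neither did, it would not be adherent to
    the interior of [D]. *)
Lemma near_agrees i s : 0 < s < 1 ->
  let x := barycenter (q i) (corner i) s in
  nbhs x (agrees_with_side i 1) \/ nbhs x (agrees_with_side i (-1)).
Proof.
move=> s01 x; have /nbhs_ballP[e /= e0 xe] := near_open_edge i s01.
have half c := @half_ball_constant i c x e xe.
have xe_nbhs : nbhs x (ball x e) by exact: nbhsx_ballx.
have x_edge : qedge i x.
  by exists s => //=; rewrite in_itv /=; case/andP: s01 => ? ?; rewrite !ltW.
have neg1 : (-1 : R) != 0 by rewrite oppr_eq0 oner_eq0.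
have off c y U := near_side (x := y) (U := U) (c := c) (ngon_edge_neq i).
have [u xu u0] := off 1 x _ (side_edge x_edge) xe_nbhs (oner_neq0 _).
have [v xv v0] := off (-1) x _ (side_edge x_edge) xe_nbhs neg1.
have [Du|nDu] := pselect (D u); have [Dv|nDv] := pselect (D v).
(* both sides in [D] *)
- suff Dx : D° x.
    by have /ngon_frontier[] : exists j, qedge j x by exists i.
  apply: filterS xe_nbhs => y xy.
  have [yneg|ypos|y0] := ltgtP (qside i y) 0.
  + by apply/(half (-1) v y) => //; rewrite mulN1r oppr_gt0.
  + by apply/(half 1 u y) => //; rewrite mul1r.
  + apply: contrapT => nDy.
    have ny : nbhs y (~` D `&` ball x e).
      apply: filterI; apply: open_nbhs_nbhs; split => //.
        exact/closed_openC/ngon_closed.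
      exact: ball_open.
    have [z [nDz xz] z0] := off 1 y _ y0 ny (oner_neq0 _).
    by apply: nDz; apply/(half 1 u z).
- left; apply: filterS xe_nbhs => y xy; split=> y0.
    by apply/(half 1 u y).
  rewrite mul1r in y0.
  by rewrite -(half (-1) v y) //; rewrite mulN1r oppr_gt0.
- right; apply: filterS xe_nbhs => y xy; split=> y0.
    by apply/(half (-1) v y).
  rewrite mulN1r oppr_lt0 in y0.
  by rewrite -(half 1 u y) //; rewrite mul1r.
(* neither side in [D] *)
- exfalso; case: (qD) => _ _ _ Dreg _.
  have Dx : D x by have /ngon_frontier[] : exists j, qedge j x by exists i.
  move: (Dx); rewrite -Dreg => /(_ _ xe_nbhs)[y [Dy xy]].
  have ny : nbhs y (D° `&` ball x e).
    apply: filterI; apply: open_nbhs_nbhs; split => //.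
      exact: open_interior.
    exact: ball_open.
  have sub : D° `<=` D by exact: interior_subset.
  have [yneg|ypos|y0] := ltgtP (qside i y) 0.
  + by apply: nDv; apply/(half (-1) v y) => //; [rewrite mulN1r oppr_gt0|exact: sub].
  + by apply: nDu; apply/(half 1 u y) => //; [rewrite mul1r|exact: sub].
  + have [z [Dz xz] z0] := off 1 y _ y0 ny (oner_neq0 _).
    by apply: nDu; apply/(half 1 u z) => //; exact: sub.
Qed.

(** The side selected by [c] is the inner side all along the open [i]-th edge. *)
Definition edge_agrees i c := forall s, 0 < s < 1 ->
  nbhs (barycenter (q i) (corner i) s) (agrees_with_side i c).

(** The inner side is locally constant along an open edge, hence constant. *)
Lemma edge_agreesE i : edge_agrees i 1 \/ edge_agrees i (-1).
Proof.
pose A : set R := `]0, 1[%classic; pose f := barycenter (q i) (corner i).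
have AP s : A s <-> 0 < s < 1 by rewrite /A /= in_itv.
have Ac : connected A by apply/connected_intervalP; exact: interval_is_interval.
clearbody A.
(* the parameters of the points near which the inner side is given by [c] *)
pose B c := f @^-1` (agrees_with_side i c)°.
have fc : continuous f by exact: barycenter_continuous.
have Bo c : open (B c) by apply: open_comp => //; exact: open_interior.
have disj s : A s -> B 1 s -> ~ B (-1) s.
  move=> /AP/andP[s0 s1] B1 B2.
  have x_edge : qedge i (f s) by exists s => //=; rewrite in_itv /= !ltW.
  have [u [u1 u2] u0] :=
    near_side (ngon_edge_neq i) (side_edge x_edge) (filterI B1 B2) (oner_neq0 _).
  by apply: u2.2 (u1.1 u0); rewrite mulN1r oppr_lt0 -[X in 0 < X]mul1r.
have cover s : A s -> B 1 s \/ B (-1) s by move=> /AP; exact: near_agrees.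
have BE c s : B c s -> nbhs (f s) (agrees_with_side i c) by [].
move: (B) Bo disj cover BE => {}B Bo disj cover BE.
have [[s [As Bs]]|none] := pselect (exists s, A s /\ B 1 s).
  left=> t /AP At; apply: BE.
  suff : (A `&` B 1) t by case.
  suff -> : A `&` B 1 = A by [].
  apply: Ac; [by exists s|by exists (B 1)|].
  exists (~` B (-1)); first exact/open_closedC.
  apply/seteqP; split=> r [Ar Br]; split=> //; first exact: disj.
  by have [] := cover r Ar.
right=> t /AP At; apply: BE.
by have [Bt|//] := cover t At; exfalso; apply: none; exists t.
Qed.

(** The inner side does not change at a corner.  Close to the corner, the convex
    sector spanned by the two edges is disjoint from the polygonal line, so it lies
    inside [D] or misses it; and it lies on the same side, given by the sign of
    [k], of both edges. *)
Lemma corner_agrees i c d : c != 0 -> d != 0 ->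
  edge_agrees i c -> edge_agrees (ordS i) d -> 0 < c * d.
Proof.
move=> c0 d0 ic Sid; set k := qside i (corner (ordS i)).
have k0 : k != 0 := ngon_corner i.
have kk : 0 < k * k by rewrite -expr2 exprn_even_gt0.
have kE : qside (ordS i) (q i) = k by rewrite /k /side /det2 !mxE; ring.
have /nbhs_ballP[e /= e0 xe] := near_corner i.
have ball_corner : nbhs (corner i) (ball (corner i) e) by exact: nbhsx_ballx.
pose sector := [set u | [/\ ball (corner i) e u,
                 0 < k * qside i u & 0 < k * qside (ordS i) u]].
have sector_const u v : sector u -> sector v -> D u <-> D v.
  move=> [xu u1 u2] [xv v1 v2]; apply: avoid_frontier ngon_closed _ => y uvy.
  move=> /ngon_frontier[j jy]; have yx := barycenter_ball xu xv uvy.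
  have [jE|jE] := xe _ yx _ jy; move: jy; rewrite jE => /side_edge.
    by case: uvy => t t01 <-; rewrite side_barycenter; exact/eqP/(convex_neq0 t01 u1 v1).
  by case: uvy => t t01 <-; rewrite side_barycenter; exact/eqP/(convex_neq0 t01 u2 v2).
have pos_open j : open [set u | 0 < k * qside j u].
  rewrite -[X in open X]/(qside j @^-1` ( *%R k @^-1` [set r | 0 < r])).
  apply: open_comp => [x _|]; first exact: side_continuous.
  by apply: open_comp => [x _|]; [exact: mulrl_continuous|exact: open_gt].
have sector_sign j b u : sector u -> agrees_with_side j b u -> b != 0 ->
    j = i \/ j = ordS i -> D u <-> 0 < b * k.
  move=> [_ u1 u2] [pos neg] b0 jE.
  have {u1 u2} : 0 < k * qside j u by case: jE => ->.
  move: (qside j u) pos neg => w pos neg kw.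
  have bk0 : b * k != 0 by rewrite mulf_neq0.
  split=> [Du|bk]; last by apply: pos; nra.
  rewrite lt0r bk0 leNgt; apply/negP => bk; apply: neg Du; nra.
(* points of the sector near points of either edge that tend to the corner *)
have sector_point j j' b (f : R -> 'rV[R]_2) (F : set_system R) :
    ProperFilter F -> edge_agrees j b -> f @ F --> corner i ->
    (\forall t \near F, 0 < t < 1 /\ f t = barycenter (q j) (corner j) t) ->
    (\forall t \near F, 0 < k * qside j' (f t)) ->
    (j = i /\ j' = ordS i) \/ (j' = i /\ j = ordS i) ->
    exists2 u, sector u & agrees_with_side j b u.
  move=> FF jb fF fE kF jj'.
  have Fball : F (f @^-1` ball (corner i) e) by exact: fF.
  have [t [[[t01 ftE] ft1] ft2]] := filter_ex (filterI (filterI fE Fball) kF).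
  have ft_edge : qedge j (f t).
    by rewrite ftE; exists t => //=; rewrite in_itv /=; case/andP: t01 => ? ?; rewrite !ltW.
  have nt : nbhs (f t) ((ball (corner i) e `&` [set u | 0 < k * qside j' u])
                        `&` agrees_with_side j b).
    apply: filterI; last by rewrite ftE; exact: jb.
    by apply: filterI; apply: open_nbhs_nbhs; split => //; exact: ball_open.
  have [u [[u1 u2] ub] u0] := near_side (ngon_edge_neq j) (side_edge ft_edge) nt k0.
  by exists u => //; case: jj' => [[ji j'i]|[j'i ji]]; rewrite ?ji ?j'i in u0 u2; split.
have at_left1 : \forall t \near (1:R)^'-, 0 < t < 1.
  near=> t; apply/andP; split; last by near: t; exact: nbhs_left_lt.
  by near: t; exact: nbhs_left_gt.
have at_right0 : \forall t \near (0:R)^'+, 0 < t < 1.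
  near=> t; apply/andP; split; first by near: t; exact: nbhs_right_gt.
  by near: t; exact: nbhs_right_lt.
have [u su iu] : exists2 u, sector u & agrees_with_side i c u.
  apply: (sector_point i (ordS i) c (barycenter (q i) (corner i)) 1^'-) => //.
  - apply: cvg_within_filter; rewrite -{2}(barycenter1 (q i) (corner i)).
    exact: barycenter_continuous.
  - by apply: filterS at_left1.
  - apply: filterS at_left1 => t /andP[t0 t1].
    by rewrite side_barycenter kE side_start mulr0 addr0 mulrCA mulr_gt0 // subr_gt0.
  - by left.
have [v sv iv] : exists2 v, sector v & agrees_with_side (ordS i) d v.
  apply: (sector_point (ordS i) i d
            (barycenter (corner i) (corner (ordS i))) 0^'+) => //.
  - apply: cvg_within_filter; rewrite -{2}(barycenter0 (corner i) (corner (ordS i))).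
    exact: barycenter_continuous.
  - by apply: filterS at_right0.
  - apply: filterS at_right0 => t /andP[t0 t1].
    by rewrite side_barycenter -/k side_end mulr0 add0r mulrCA mulr_gt0.
  - by right.
have := sector_const _ _ su sv.
rewrite (sector_sign i c u) //; last by left.
rewrite (sector_sign (ordS i) d v) //; last by right.
move=> ck_dk; have ck0 : c * k != 0 by rewrite mulf_neq0.
suff : 0 < (c * k) * (d * k) by rewrite mulrACA pmulr_lgt0.
have [ck|ck] := boolP (0 < c * k); first by rewrite mulr_gt0 //; exact/ck_dk.
have {}ck : c * k < 0 by rewrite lt_neqAle ck0 leNgt.
have dk : d * k < 0.
  by rewrite lt_neqAle mulf_neq0 // leNgt; apply/negP => /ck_dk; rewrite ltNge ltW.
by rewrite nmulr_rgt0.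
Unshelve. all: by end_near.
Qed.

(** The interior of a simple polygon is on the same side of all its edges. *)
Lemma ngon_agrees : (0 < n)%N ->
  exists2 c, c = 1 \/ c = -1 & forall i, edge_agrees i c.
Proof.
move=> n0; pose i0 := Ordinal n0.
have [c c1 ic] : exists2 c, c = 1 \/ c = -1 & edge_agrees i0 c.
  by have [] := edge_agreesE i0; [exists 1|exists (-1)] => //; [left|right].
exists c => //; apply: (ordS_ind (i0 := i0)) => // i {}ic.
have neg1 : (-1 : R) != 0 by rewrite oppr_eq0 oner_eq0.
have [di|di] := edge_agreesE (ordS i).
  case: c1 ic => -> // ic; have := corner_agrees neg1 (oner_neq0 _) ic di.
  by rewrite mulr1 ltr0N1.
case: c1 ic => -> // ic; have := corner_agrees (oner_neq0 _) neg1 ic di.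
by rewrite mul1r ltr0N1.
Qed.

End Polygon.

End Polygon_interior.

(** * Orientation of triangles in space, and projection from an apex *)

Section Space.
Local Open Scope classical_set_scope.
Local Open Scope ring_scope.
Context {R : realType}.

(** The vector product in space. *)
Definition cross (u v : 'rV[R]_3) : 'rV[R]_3 := \row_j
  if j == 0 then u 0 1 * v 0 2 - u 0 2 * v 0 1
  else if j == 1 then u 0 2 * v 0 0 - u 0 0 * v 0 2
  else u 0 0 * v 0 1 - u 0 1 * v 0 0.

Lemma tripleE (u v w : 'rV[R]_3) : triple u v w =
  u 0 0 * (v 0 1 * w 0 2 - v 0 2 * w 0 1) -
  u 0 1 * (v 0 0 * w 0 2 - v 0 2 * w 0 0) +
  u 0 2 * (v 0 0 * w 0 1 - v 0 1 * w 0 0).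
Proof.
rewrite /triple (det_mx33 (col_mx u (col_mx v w) : 'M[R]_(1 + (1 + 1), 3))).
have [-> -> ->] := col_mx3E u v w 0; have [-> -> ->] := col_mx3E u v w 1.
by have [-> -> ->] := col_mx3E u v w 2.
Qed.

Lemma dot3E (u v : 'rV[R]_3) :
  (u *m v^T) 0 0 = u 0 0 * v 0 0 + u 0 1 * v 0 1 + u 0 2 * v 0 2.
Proof.
have l1 : lift ord0 ord0 = 1 :> 'I_3 by exact: val_inj.
have l2 : lift ord0 (lift ord0 ord0) = 2 :> 'I_3 by exact: val_inj.
by rewrite mxE !big_ord_recl big_ord0 l2 l1 !mxE addr0 addrA.
Qed.

Lemma triple_cross (u v w : 'rV[R]_3) : triple u v w = (u *m (cross v w)^T) 0 0.
Proof. by rewrite tripleE dot3E !mxE /=; ring. Qed.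

Lemma cross_orthl (u v : 'rV[R]_3) : cross u v *m u^T = 0.
Proof. by apply/matrixP => i j; rewrite !ord1 dot3E !mxE /=; ring. Qed.

Lemma cross_orthr (u v : 'rV[R]_3) : cross u v *m v^T = 0.
Proof. by apply/matrixP => i j; rewrite !ord1 dot3E !mxE /=; ring. Qed.

Lemma dot_self_gt0 (u : 'rV[R]_3) : u != 0 -> 0 < (u *m u^T) 0 0.
Proof.
move=> u0; rewrite dot3E -!expr2 lt0r !addr_ge0 ?sqr_ge0 // andbT.
apply: contra u0; rewrite !paddr_eq0 ?addr_ge0 ?sqr_ge0 // !sqrf_eq0.
move=> /andP[/andP[/eqP u0 /eqP u1] /eqP u2].
apply/eqP/rowP => -[[|[|[|//]]] i]; rewrite mxE.
- by rewrite -u0; congr (u _ _); exact: val_inj.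
- by rewrite -u1; congr (u _ _); exact: val_inj.
- by rewrite -u2; congr (u _ _); exact: val_inj.
Qed.

(** For a triangle, the sum that defines the orientation is a single triple
    product. *)
Lemma triangle_area (w x y z : 'rV[R]_3) : uniq [:: x; y; z] ->
  \sum_(v <- [:: x; y; z]) triple w v (next [:: x; y; z] v) =
  triple w (y - x) (z - x).
Proof.
rewrite /= !inE negb_or => /andP[/andP[/negPf xy /negPf xz] /andP[/negPf yz _]].
rewrite !big_cons big_nil /= !eqxx !(eq_sym y x) !(eq_sym z) xy xz yz !tripleE !mxE.
ring.
Qed.

Lemma triple_rot (w x y z : 'rV[R]_3) :
  triple w (z - y) (x - y) = triple w (y - x) (z - x).
Proof. by rewrite !tripleE !mxE; ring. Qed.

Lemma triple_flip (w x y z : 'rV[R]_3) :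
  triple w (x - y) (z - y) = - triple w (y - x) (z - x).
Proof. by rewrite !tripleE !mxE; ring. Qed.

Lemma face_interior_perm (f g : seq 'rV[R]_3) :
  perm_eq f g -> face_interior f = face_interior g.
Proof.
move=> fg; apply/seteqP; split=> x [l [l0 l1 xl]]; exists l; split.
- by move=> v; rewrite -(perm_mem fg); exact: l0.
- by rewrite -(perm_big _ fg).
- by rewrite -(perm_big _ fg).
- by move=> v; rewrite (perm_mem fg); exact: l0.
- by rewrite (perm_big _ fg).
- by rewrite (perm_big _ fg).
Qed.

Lemma outward_normal_perm S (f g : seq 'rV[R]_3) w :
  perm_eq f g -> outward_normal S f w -> outward_normal S g w.
Proof.
move=> fg [orth out]; split; last by rewrite -(face_interior_perm fg).
by move=> x y; rewrite -!(perm_mem fg); exact: orth.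
Qed.

Lemma anticlockwise_rot S (x y z : 'rV[R]_3) : uniq [:: x; y; z] ->
  anticlockwise S [:: x; y; z] -> anticlockwise S [:: y; z; x].
Proof.
move=> xyz [w [wout]]; rewrite triangle_area // => wpos.
have pr : perm_eq [:: x; y; z] [:: y; z; x].
  by rewrite perm_sym; apply/permPl; exact: (perm_rot 1 [:: x; y; z]).
exists w; split; first exact: outward_normal_perm wout.
rewrite triangle_area; last by rewrite -(perm_uniq pr).
by rewrite triple_rot.
Qed.

Section Coordinates.
Variables (o a : 'rV[R]_3) (E : 'M[R]_(2, 3)).
Let d := \det (col_mx E (a - o) : 'M[R]_(2 + 1, 3)).
Hypothesis d0 : d != 0.

(** The vector with coordinates [(v, h)] in the frame formed by the rows of [E] and
    the vector from [o] to [a]; [h] is the height above the base plane, scaled so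
    that [a] has height 1. *)
Definition at_coord (v : 'rV[R]_2) (h : R) : 'rV[R]_3 := v *m E + h *: (a - o).

Lemma at_coordE v h : at_coord v h = row_mx v h%:M *m (col_mx E (a - o)).
Proof. by rewrite mul_row_col mul_scalar_mx. Qed.

Lemma frame_unit : (col_mx E (a - o) : 'M[R]_(2 + 1, 3)) \in unitmx.
Proof. by rewrite unitmxE unitfE. Qed.

Lemma at_coord_inj v h v' h' : at_coord v h = at_coord v' h' -> v = v' /\ h = h'.
Proof.
rewrite !at_coordE => /(can_inj (mulmxK frame_unit)) /eq_row_mx[-> /matrixP hh'].
by split => //; have := hh' 0 0; rewrite !mxE !mulr1n.
Qed.

Lemma at_coord_surj x : exists v h, x = at_coord v h.
Proof.
pose y := x *m invmx (col_mx E (a - o) : 'M[R]_(2 + 1, 3)).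
exists (lsubmx (y : 'rV_(2 + 1))), (rsubmx (y : 'rV_(2 + 1)) 0 0).
by rewrite at_coordE -mx11_scalar hsubmxK mulmxKV // frame_unit.
Qed.

Lemma det_col_at_coord v h :
  \det (col_mx E (at_coord v h) : 'M[R]_(2 + 1, 3)) = h * d.
Proof.
have -> : col_mx E (at_coord v h) = block_mx 1%:M 0 v h%:M *m col_mx E (a - o).
  by rewrite mul_block_col mul1mx mul0mx addr0 at_coordE mul_row_col.
by rewrite det_mulmx det_lblock det1 mul1r det_scalar1.
Qed.

(** The triple product that decides the orientation of a lateral face, in
    coordinates: [e] is the direction of the base edge, which starts at [p]. *)
Lemma triple_at_coord (e p w : 'rV[R]_2) h :
  triple (at_coord w h) (e *m E) (at_coord (- p) 1) =
  - det2 e (w + h *: p) * d.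
Proof.
pose C := col_mx (row_mx w h%:M) (col_mx (row_mx e 0) (row_mx (- p) 1%:M))
          : 'M[R]_(1 + (1 + 1), 2 + 1).
rewrite /triple; have -> : col_mx (at_coord w h) (col_mx (e *m E) (at_coord (- p) 1)) =
    C *m col_mx E (a - o).
  rewrite !mul_col_mx -!at_coordE; congr (col_mx _ (col_mx _ _)).
  by rewrite mul_row_col mul0mx addr0.
rewrite det_mulmx; congr (_ * _); rewrite -/(triple _ _ _) tripleE.
have rowE (u : 'rV[R]_2) (k : R) : let r := row_mx u k%:M : 'rV[R]_(2 + 1) in
    [/\ r 0 0 = u 0 0, r 0 1 = u 0 1 & r 0 2 = k].
  split.
  - by rewrite -(row_mxEl u k%:M 0 0); congr (row_mx _ _ _ _); exact: val_inj.
  - by rewrite -(row_mxEl u k%:M 0 1); congr (row_mx _ _ _ _); exact: val_inj.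
  - transitivity ((k%:M : 'M[R]_1) 0 0); last by rewrite mxE mulr1n.
    by rewrite -(row_mxEr u k%:M 0 0); congr (row_mx _ _ _ _); exact: val_inj.
have [-> -> ->] := rowE w h; have [-> -> ->] := rowE (- p) 1.
have -> : (0 : 'M[R]_(1,1)) = 0%:M by apply/matrixP => i j; rewrite !mxE mul0rn.
have [-> -> ->] := rowE e 0.
by rewrite /det2 !mxE; ring.
Qed.

End Coordinates.

(** Strictly between the base plane and the level of [a], the bipyramid is seen
    from [a] as [D]: a point belongs to it iff its projection from [a] to the base
    plane belongs to [D].  The other pyramid has only points of height at most 0. *)
Lemma solid_at_coord n (p : 'I_n -> 'rV[R]_3) (D : set 'rV[R]_2) o E a b
    (v : 'rV[R]_2) (h : R) :
  \det (col_mx E (a - o) : 'M[R]_(2 + 1, 3)) *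
    \det (col_mx E (b - o) : 'M[R]_(2 + 1, 3)) < 0 ->
  0 < h < 1 ->
  (solid (pyramid p (place o E @` D) a) `|` solid (pyramid p (place o E @` D) b))
    (o + at_coord o a E v h) <-> D ((1 - h)^-1 *: v).
Proof.
move=> ab /andP[h0 h1]; set d := \det _ in ab.
have d0 : d != 0 by apply: contraTneq ab => ->; rewrite mul0r ltxx.
have h1' : 1 - h != 0 by rewrite subr_eq0 gt_eqF.
split=> [[[_ [t [[y Dy <-] t01 e]]]|[_ [t [[y Dy <-] /andP[t0 _] e]]]]|Dv].
- have {}e : at_coord o a E v h = at_coord o a E ((1 - t) *: y) t.
    apply: (addrI o); rewrite e /barycenter /place /at_coord -scalemxAl.
    by apply/rowP => j; rewrite !mxE; ring.
  by have [-> <-] := at_coord_inj d0 e; rewrite scalerA mulVf ?scale1r.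
- have [w [k bE]] := at_coord_surj d0 (b - o).
  move: ab; rewrite bE det_col_at_coord -/d mulrCA pmulr_llt0; last first.
    by rewrite -expr2 exprn_even_gt0.
  (* [k] is the height of [b] *)
  move=> k0; have {}e :
      at_coord o a E v h = at_coord o a E ((1 - t) *: y + t *: w) (t * k).
    apply: (addrI o); rewrite e -[b](subrK o) bE /barycenter /place /at_coord.
    rewrite mulmxDl -!scalemxAl.
    by apply/rowP => j; rewrite !mxE; ring.
  have [_ hE] := at_coord_inj d0 e.
  by move: h0; rewrite hE ltNge mulr_ge0_le0 // ltW.
- left; exists (place o E ((1 - h)^-1 *: v)), h; split.
  + by exists ((1 - h)^-1 *: v).
  + by rewrite !ltW.
  rewrite /barycenter /place /at_coord -scalemxAl [(1 - h) *: _]scalerDr scalerA.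
  rewrite mulfV // scale1r.
  by apply/rowP => j; rewrite !mxE; ring.
Qed.

End Space.

(** * Outward normals and orientation of the lateral faces *)

Section Lateral_faces.
Local Open Scope classical_set_scope.
Local Open Scope ring_scope.
Context {R : realType}.

Lemma near_right_opp (P : set R) :
  (\forall t \near (0 : R), P t) -> \forall t \near (0 : R)^'+, P t /\ P (- t).
Proof.
move=> P0; have opp0 : - t @[t --> (0 : R)^'+] --> - (0 : R).
  by apply: cvg_within_filter; exact: opp_continuous.
rewrite oppr0 in opp0; apply: filterI; last exact: opp0.
by apply: filterS P0 => t Pt _.
Qed.

Section Bipyramid_faces.
Variables (n : nat) (q : 'I_n -> 'rV[R]_2) (D : set 'rV[R]_2).
Variables (o : 'rV[R]_3) (E : 'M[R]_(2, 3)) (a b : 'rV[R]_3) (c : R).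
Hypothesis qD : is_ngon q D.
Hypothesis qc : forall i, edge_agrees q D i c.
Let p := place o E \o q.
Let B := place o E @` D.
Let S := solid (pyramid p B a) `|` solid (pyramid p B b).
Let d := \det (col_mx E (a - o) : 'M[R]_(2 + 1, 3)).
Hypothesis ab : d * \det (col_mx E (b - o) : 'M[R]_(2 + 1, 3)) < 0.
Hypothesis c0 : c != 0.

Let d0 : d != 0.
Proof. by apply: contraTneq ab => ->; rewrite mul0r ltxx. Qed.

Lemma base_edgeE i : p (ordS i) - p i = (q (ordS i) - q i) *m E.
Proof. by rewrite /p /= /place opprD addrACA subrr add0r -mulmxBl. Qed.

Lemma apex_edgeE i : a - p i = at_coord o a E (- q i) 1.
Proof.
rewrite /p /= /place /at_coord mulNmx scale1r.
by apply/rowP => j; rewrite !mxE; ring.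
Qed.

Lemma face_interior_coord i x : face_interior [:: p i; p (ordS i); a] x ->
  exists s h, [/\ 0 < s < 1, 0 < h < 1 &
    x = o + at_coord o a E ((1 - h) *: barycenter (q i) (q (ordS i)) s) h].
Proof.
move=> [l [l0 l1 ->]].
have := l0 a; have := l0 (p (ordS i)); have := l0 (p i).
move: l1; rewrite !inE !eqxx !orbT !big_cons !big_nil !addr0.
move: (l (p i)) (l (p (ordS i))) (l a) => x1 x2 x3 x123 /(_ isT) x10 /(_ isT) x20 /(_ isT) x30.
have x12 : x1 + x2 != 0 by rewrite gt_eqF // addr_gt0.
exists (x2 / (x1 + x2)), x3; split.
- by rewrite divr_gt0 ?addr_gt0 //= ltr_pdivrMr ?addr_gt0 // mul1r ltrDr.
- by apply/andP; split; lra.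
- have {x123 x30} -> : x3 = 1 - (x1 + x2) by rewrite -x123; ring.
  rewrite /at_coord /barycenter /p /= /place -!scalemxAl !mulmxDl -!scalemxAl.
  by apply/rowP => j; rewrite !mxE; field.
Qed.

(** For small [t], the point with coordinates [(v + t w, h + t k)] has its height
    strictly between 0 and 1, and its projection from the apex to the base plane is
    so close to the [i]-th edge that [D] is there the inner side of that edge. *)
Lemma near_projection i s h (w : 'rV[R]_2) k : 0 < s < 1 -> 0 < h < 1 ->
  let v := (1 - h) *: barycenter (q i) (q (ordS i)) s in
  \forall t \near (0 : R), 0 < h + t * k < 1 /\
    agrees_with_side q D i c ((1 - (h + t * k))^-1 *: (v + t *: w)).
Proof.
move=> s01 /andP[h0 h1] v.
have hk : h + t * k @[t --> (0:R)] --> h + 0 * k.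
  by apply: cvgD; [exact: cvg_cst|exact: mulrr_continuous].
rewrite mul0r addr0 in hk.
apply: filterI.
  near=> t; apply/andP; split; near: t.
    exact: (cvgr_gt _ hk).
  exact: (cvgr_lt _ hk).
suff cv : (1 - (h + t * k))^-1 *: (v + t *: w) @[t --> (0:R)] -->
    barycenter (q i) (q (ordS i)) s.
  by apply: cv; exact: qc.
have h1' : 1 - h != 0 by rewrite subr_eq0 gt_eqF.
have -> : barycenter (q i) (q (ordS i)) s = (1 - h)^-1 *: (v + (0:R) *: w).
  by rewrite scale0r addr0 scalerA mulVf // scale1r.
apply: cvgZ.
  by apply: cvgV => //; apply: cvgB => //; exact: cvg_cst.
by apply: cvgD; [exact: cvg_cst|apply: cvgZr_tmp; exact: cvg_id].
Unshelve. all: by end_near.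
Qed.

(** That projection lies on the side of the [i]-th edge given by the sign of [t]
    and of a quantity that depends only on the direction [(w, k)]. *)
Lemma side_projection i s h (w : 'rV[R]_2) k t : h + t * k != 1 ->
  let v := (1 - h) *: barycenter (q i) (q (ordS i)) s in
  side (q i) (q (ordS i)) ((1 - (h + t * k))^-1 *: (v + t *: w)) =
  t * (1 - (h + t * k))^-1 * det2 (q (ordS i) - q i) (w + k *: q i).
Proof.
rewrite eq_sym -subr_eq0 => hk; rewrite /side /det2 !mxE.
by field.
Qed.

(** The lateral face on the [i]-th edge has an outward normal whose scalar product
    with the vector product of the two sides of the face issued from [p i] has the
    sign of [c * d]. *)
Lemma face_normal i : exists2 w,
  forall f, perm_eq [:: p i; p (ordS i); a] f -> outward_normal S f w &
  0 < c * d * triple w (p (ordS i) - p i) (a - p i).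
Proof.
pose e := q (ordS i) - q i; pose u := p (ordS i) - p i; pose z := a - p i.
pose w := (c * d) *: cross u z.
have cd0 : 0 < (c * d) * (c * d) by rewrite -expr2 exprn_even_gt0 // mulf_neq0.
have cross0 : cross u z != 0.
  (* the two sides of the face are independent: some triple product is nonzero *)
  have [y] := side_off (ngon_edge_neq qD i); apply: contraNneq => uz0.
  have := triple_at_coord o a E e (q i) (y - q i) 0.
  rewrite -base_edgeE -apex_edgeE triple_cross uz0 trmx0 mulmx0 mxE scale0r addr0.
  by move/esym/eqP; rewrite mulf_eq0 oppr_eq0 (negPf d0) orbF.
have wpos : 0 < c * d * triple w u z.
  by rewrite triple_cross /w -scalemxAl mxE mulrA mulr_gt0 // dot_self_gt0.
exists w => // f pf; apply: outward_normal_perm pf _; split.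
  have orth y : y \in [:: p i; p (ordS i); a] -> w *m (y - p i)^T = 0.
    rewrite !inE => /or3P[] /eqP ->; first by rewrite subrr trmx0 mulmx0.
      by rewrite /w -scalemxAl cross_orthl scaler0.
    by rewrite /w -scalemxAl cross_orthr scaler0.
  move=> x y /orth wx /orth wy.
  have -> : y - x = (y - p i) - (x - p i) by rewrite opprB addrA subrK.
  by rewrite linearB mulmxBr wx wy subr0.
move=> x /face_interior_coord[s [h [s01 h01 xE]]].
have [v [k wE]] := at_coord_surj d0 w.
(* [w] has coordinates [(v, k)]; moving along it crosses the edge outwards *)
have ce : c * det2 e (v + k *: q i) < 0.
  move: wpos; rewrite wE /u base_edgeE /z apex_edgeE triple_at_coord -/d.
  rewrite -/e; set m := det2 _ _ => m0.
  have dd : 0 < d * d by rewrite -expr2 exprn_even_gt0.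
  rewrite -(pmulr_llt0 _ dd); move: m0; rewrite -oppr_lt0; congr (_ < 0); ring.
have solidE v' h' : 0 < h' < 1 ->
    S (o + at_coord o a E v' h') <-> D ((1 - h')^-1 *: v').
  exact: solid_at_coord.
have near0 := near_projection i v k s01 h01.
have shift t : x + t *: w =
    o + at_coord o a E ((1 - h) *: barycenter (q i) (q (ordS i)) s + t *: v) (h + t * k).
  rewrite xE wE /at_coord mulmxDl -scalemxAl.
  by apply/rowP => j; rewrite !mxE; ring.
have near_pos : \forall t \near (0:R)^'+, 0 < t by exact: nbhs_right_gt.
apply: filterS (filterI near_pos (near_right_opp near0)) => t /=.
move=> [t0 [[/andP[p0 p1] [_ agp]] [/andP[m0 m1] [agm _]]]]; split.
  rewrite shift solidE ?p0 //; apply: agp.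
  rewrite side_projection ?lt_eqF // -/e mulrCA pmulr_rlt0 //.
  by rewrite mulr_gt0 // invr_gt0 subr_gt0.
rewrite -scaleNr shift solidE ?m0 //; apply: agm.
rewrite side_projection ?lt_eqF // -/e mulrCA nmulr_rgt0 //.
by rewrite nmulr_rlt0 ?oppr_lt0 // invr_gt0 subr_gt0.
Qed.

Lemma base_inj : injective p.
Proof.
move=> i j /(addrI o) qij; apply: (ngon_inj qD).
have : at_coord o a E (q i) 0 = at_coord o a E (q j) 0.
  by rewrite /at_coord qij.
by case/(at_coord_inj d0).
Qed.

Lemma apex_neq i : p i != a.
Proof.
apply/eqP => pa; have := apex_edgeE i; rewrite pa subrr.
have <- : at_coord o a E 0 0 = 0 by rewrite /at_coord mul0mx scale0r addr0.
by case/(at_coord_inj d0) => _ /esym/eqP; rewrite oner_eq0.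
Qed.

Lemma face_uniq i : uniq [:: p i; p (ordS i); a].
Proof.
rewrite /= !inE negb_or !apex_neq !andbT (inj_eq base_inj).
by apply: contra (ngon_edge_neq qD i) => /eqP <-.
Qed.

(** If [c * d] is positive, the interior of [D] is to the left of every edge for
    an observer at [a], so the face runs along its base edge in the direction of
    the base. *)
Lemma face_anticlockwise i : 0 < c * d -> anticlockwise S [:: p i; p (ordS i); a].
Proof.
move=> cd; have [w wout wpos] := face_normal i.
exists w; split; first exact: wout.
by rewrite triangle_area ?face_uniq // -(pmulr_rgt0 _ cd).
Qed.

(** If [c * d] is negative, it runs along its base edge the other way. *)
Lemma face_clockwise i : c * d < 0 -> anticlockwise S [:: p (ordS i); p i; a].
Proof.
move=> cd; have [w wout wpos] := face_normal i.
have pf : perm_eq [:: p i; p (ordS i); a] [:: p (ordS i); p i; a].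
  by rewrite (perm_catCA [:: _] [:: _] [:: _]).
exists w; split; first exact: wout.
rewrite triangle_area; last by rewrite -(perm_uniq pf) face_uniq.
by rewrite triple_flip oppr_gt0 -(nmulr_rgt0 _ cd).
Qed.

End Bipyramid_faces.

End Lateral_faces.

(** * The labelling *)

Section Labelling.
Local Open Scope classical_set_scope.
Local Open Scope ring_scope.
Context {R : realType}.

Lemma fset2_inj (T : choiceType) (x y x' y' : T) :
  [fset x; y]%fset = [fset x'; y']%fset ->
  (x = x' /\ y = y') \/ (x = y' /\ y = x').
Proof.
move=> /fsetP e; have {}e u : (u == x) || (u == y) = (u == x') || (u == y').
  by have := e u; rewrite !in_fset2.
have hx : x = x' \/ x = y'.
  by have := e x; rewrite eqxx => /esym/orP[]/eqP->; [left|right].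
have hy : y = x' \/ y = y'.
  by have := e y; rewrite eqxx orbT => /esym/orP[]/eqP->; [left|right].
have hx' : x' = x \/ x' = y.
  by have := e x'; rewrite eqxx => /orP[]/eqP->; [left|right].
have hy' : y' = x \/ y' = y.
  by have := e y'; rewrite eqxx orbT => /orP[]/eqP->; [left|right].
by case: hx; case: hy; case: hx'; case: hy' => *;
  first [by left; split; congruence|by right; split; congruence].
Qed.

Lemma boundary_edges3 (x y z : 'rV[R]_3) : uniq [:: x; y; z] ->
  boundary_edges [:: x; y; z] = [:: [fset x; y]; [fset y; z]; [fset z; x]]%fset.
Proof.
rewrite /= !inE negb_or => /andP[/andP[/negPf xy /negPf xz] /andP[/negPf yz _]].
by rewrite /boundary_edges /= !eqxx !(eq_sym y x) !(eq_sym z) xy xz yz.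
Qed.

(** The condition that a coherent labelling satisfies on a single face [f]. *)
Definition coherent_face (S : set 'rV[R]_3) (label : {fset 'rV[R]_3} -> int) f :=
  exists c, [/\ traversal f c, anticlockwise S c
              & sorted <%R [seq label e | e <- boundary_edges c]].

(** Labels of the edges that join the [m]-th vertex of the base to the first and to
    the second apex, and of the [m]-th edge of the base.  Around the base, from the
    vertex 0 on, the first family decreases and the second increases; base edges
    get a label above all others, except the last one, whose label falls between
    those of its two neighbours in either family. *)
Definition top_label m : int := if m == 0%N then 1 else - m%:Z.
Definition bottom_label m : int := if m == 0%N then -1 else m%:Z.
Definition base_label n m : int := if m.+1 == n then 0 else n%:Z.

(** The labelling of the unordered pairs of points induced by the labels above, 0
    on the pairs that are not edges. *)
Definition bipyramid_label n (p : 'I_n -> 'rV[R]_3) (a b : 'rV[R]_3)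
    (e : {fset 'rV[R]_3}) : int :=
  if [pick i | e == [fset p i; a]%fset] is Some i then top_label i else
  if [pick i | e == [fset p i; b]%fset] is Some i then bottom_label i else
  if [pick i | e == [fset p i; p (ordS i)]%fset] is Some i then base_label n i
  else 0.

Section Labels.
Variables (n : nat) (p : 'I_n -> 'rV[R]_3) (a b : 'rV[R]_3).
Hypothesis pinj : injective p.
Hypothesis pa : forall i, p i != a.
Hypothesis pb : forall i, p i != b.
Hypothesis ab : a != b.
Hypothesis SS : forall i : 'I_n, ordS (ordS i) != i.
Notation label := (bipyramid_label p a b).

Lemma label_top i : label [fset p i; a]%fset = top_label i.
Proof.
rewrite /bipyramid_label; case: pickP => [j /eqP/fset2_inj|/(_ i)]; last by rewrite eqxx.
move=> [[/pinj -> //]|[/eqP]]; by rewrite (negPf (pa i)).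
Qed.

Lemma label_bottom i : label [fset p i; b]%fset = bottom_label i.
Proof.
rewrite /bipyramid_label; case: pickP => [j /eqP/fset2_inj[] [/eqP+ /eqP]|_].
- by rewrite (eq_sym b) (negPf ab).
- by rewrite (negPf (pa i)).
case: pickP => [j /eqP/fset2_inj|/(_ i)]; last by rewrite eqxx.
move=> [[/pinj -> //]|[/eqP]]; by rewrite (negPf (pb i)).
Qed.

Lemma label_base i : label [fset p i; p (ordS i)]%fset = base_label n i.
Proof.
rewrite /bipyramid_label; case: pickP => [j /eqP/fset2_inj[] [/eqP+ /eqP]|_].
- by rewrite (negPf (pa (ordS i))).
- by rewrite (negPf (pa i)).
case: pickP => [j /eqP/fset2_inj[] [/eqP+ /eqP]|_].
- by rewrite (negPf (pb (ordS i))).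
- by rewrite (negPf (pb i)).
case: pickP => [j /eqP/fset2_inj|/(_ i)]; last by rewrite eqxx.
move=> [[/pinj -> //]|[/pinj iE /pinj jE]].
by have := SS i; rewrite jE -iE eqxx.
Qed.

End Labels.

(** The labelling is coherent when the base runs anticlockwise for an observer at
    [a]. *)
Lemma bipyramid_coherent n (q : 'I_n -> 'rV[R]_2) (D : set 'rV[R]_2) o E a b c :
  let p := place o E \o q in let B := place o E @` D in
  let S := solid (pyramid p B a) `|` solid (pyramid p B b) in
  is_ngon q D -> (forall i, edge_agrees q D i c) ->
  \det (col_mx E (a - o) : 'M[R]_(2 + 1, 3)) *
    \det (col_mx E (b - o) : 'M[R]_(2 + 1, 3)) < 0 ->
  0 < c * \det (col_mx E (a - o) : 'M[R]_(2 + 1, 3)) ->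
  exists label, forall i, coherent_face S label [:: p i; p (ordS i); a] /\
                          coherent_face S label [:: p i; p (ordS i); b].
Proof.
move=> p B S qD qc; set da := \det _; set db := \det _ => dab ca.
have dba : db * da < 0 by rewrite mulrC.
have c0 : c != 0 by apply: contraTneq ca => ->; rewrite mul0r ltxx.
have cb : c * db < 0.
  by rewrite -(pmulr_llt0 _ ca) mulrACA -expr2 pmulr_rlt0 ?exprn_even_gt0 // mulrC.
have SC : S = solid (pyramid p B b) `|` solid (pyramid p B a) by rewrite /S setUC.
have pinj : injective p := base_inj qD dab.
have pa i : p i != a := apex_neq q dab i.
have pb i : p i != b := apex_neq q dba i.
have neq_ab : a != b.
  apply: contraTneq dab => abE; rewrite /da /db abE -expr2.
  by rewrite -leNgt sqr_ge0.
have SS (i : 'I_n) : ordS (ordS i) != i.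
  by apply: contraNneq (ngon_corner qD i) => ->; rewrite side_start.
have ua i : uniq [:: p i; p (ordS i); a] := face_uniq qD dab i.
have ub i : uniq [:: p i; p (ordS i); b] := face_uniq qD dba i.
have ta i : anticlockwise S [:: p i; p (ordS i); a] := face_anticlockwise qD qc dab c0 i ca.
have tb i : anticlockwise S [:: p (ordS i); p i; b].
  by rewrite SC; exact: face_clockwise qD qc dba c0 i cb.
have rot_uniq (x y z : 'rV[R]_3) : uniq [:: x; y; z] -> uniq [:: y; z; x].
  by move=> u; rewrite -(rot_uniq 1 [:: x; y; z]) in u.
have swap_uniq (x y z : 'rV[R]_3) : uniq [:: x; y; z] -> uniq [:: y; x; z].
  rewrite /= !inE !negb_or (eq_sym y x) => /andP[/andP[-> ->] /andP[-> _]] //.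
exists (bipyramid_label p a b) => i.
have lt := label_top b pinj pa.
have lb := label_bottom pinj pa pb neq_ab.
have le := label_base pinj pa pb SS.
have lt' j : bipyramid_label p a b [fset a; p j]%fset = top_label j by rewrite fsetUC lt.
have lb' j : bipyramid_label p a b [fset b; p j]%fset = bottom_label j.
  by rewrite fsetUC lb.
have le' j : bipyramid_label p a b [fset p (ordS j); p j]%fset = base_label n j.
  by rewrite fsetUC le.
have [iS|iS] := ltnP i.+1 n.
  have SiE : ordS i = i.+1 :> nat by rewrite /= modn_small.
  split.
    (* top (i + 1) < top i < base i *)
    exists [:: p (ordS i); a; p i]; split.
    - by exists 1%N; left.
    - exact: anticlockwise_rot.
    - rewrite boundary_edges3; last exact: rot_uniq.
      rewrite [map _ _]/= lt lt' le SiE /top_label /base_label (ltn_eqF iS) /=.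
      by case: (i : nat) iS => [|m] iS /=; lia.
  (* bottom i < bottom (i + 1) < base i *)
  exists [:: p i; b; p (ordS i)]; split.
  - by exists 2%N; right.
  - by apply: anticlockwise_rot => //; exact: swap_uniq.
  - rewrite boundary_edges3; last exact/rot_uniq/swap_uniq.
    rewrite [map _ _]/= lb lb' le' SiE /bottom_label /base_label (ltn_eqF iS) /=.
    by case: (i : nat) iS => [|m] iS /=; lia.
have iE : i.+1 = n by apply/eqP; rewrite eqn_leq iS andbT.
have SiE : ordS i = 0%N :> nat by rewrite /= iE modnn.
have i0 : (i : nat) != 0%N.
  by apply: contraNneq (SS i) => i0; apply/eqP/val_inj; rewrite /= iE modnn i0 -iE i0.
split.
  (* top (n - 1) < base (n - 1) < top 0 *)
  exists [:: a; p i; p (ordS i)]; split.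
  - by exists 2%N; left.
  - by apply: anticlockwise_rot; [exact: rot_uniq|exact: anticlockwise_rot].
  - rewrite boundary_edges3; last exact/rot_uniq/rot_uniq.
    rewrite [map _ _]/= lt lt' le SiE /top_label /base_label iE !eqxx (negPf i0) /=.
    by case: (i : nat) i0 => [|m] //.
(* bottom 0 < base (n - 1) < bottom (n - 1) *)
exists [:: b; p (ordS i); p i]; split.
- by exists 0%N; right.
- apply: anticlockwise_rot; [exact/rot_uniq/swap_uniq|].
  by apply: anticlockwise_rot => //; exact: swap_uniq.
- rewrite boundary_edges3; last exact/rot_uniq/rot_uniq/swap_uniq.
  rewrite [map _ _]/= lb lb' le' SiE /bottom_label /base_label iE !eqxx (negPf i0) /=.
  by case: (i : nat) i0 => [|m] // _; lia.
Qed.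

End Labelling.

Theorem theorem5p1 (R : realType) (n : nat) (n_ge3 : (3 <= n)%N)
    (P : polyhedron R) (P_bipyramid : is_bipyramid n P) :
  exists label : {fset 'rV[R]_3} -> int, coherent P label.
Proof.
case: P_bipyramid => q [D [ o [E [a [b [qD _ dab ->]]]]]].
have [c c1 qc] := ngon_agrees qD (ltn_trans (isT : 0 < 2)%N n_ge3).
set p := (place o E \o q)%FUN; set B := [set place o E x | x in D]%classic.
set da := (\det (col_mx E (a - o)))%R in dab.
set db := (\det (col_mx E (b - o)))%R in dab.
have c0 : (c != 0)%R by case: c1 => ->; rewrite ?oppr_eq0 oner_eq0.
have da0 : (da != 0)%R by apply: contraTneq dab => ->; rewrite mul0r ltxx.
have facesE f : f \in faces (Defs.glue (codom p) (pyramid p B a) (pyramid p B b)) ->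
    exists i, f = [:: p i; p (ordS i); a] \/ f = [:: p i; p (ordS i); b].
  rewrite /Defs.glue /= !eqxx mem_cat => /orP[] /mapP[i _ ->]; exists i.
    by left.
  by right.
have [ca|ca] := ltrP 0%R (c * da)%R.
  have [label coh] := bipyramid_coherent qD qc dab ca.
  by exists label => f /facesE[i [->|->]]; have [] := coh i.
(* otherwise the base runs anticlockwise seen from [b]: exchange the apices *)
have cb : (0 < c * db)%R.
  have {}ca : (c * da < 0)%R by rewrite lt_neqAle ca mulf_neq0.
  by rewrite -(nmulr_rlt0 _ ca) mulrACA -expr2 pmulr_rlt0 // exprn_even_gt0.
rewrite mulrC in dab.
have [label coh] := bipyramid_coherent qD qc dab cb.
exists label => f /facesE[i fi]; rewrite /Defs.glue /= setUC.
by case: fi => ->; have [] := coh i.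
Qed.
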